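(* Let $D$ be an oriented graph with underlying graph $G$. Then $$\vec{\chi}(D)\leq \tfrac13\Delta(G)+2,\qquad \vec{\chi}(D)\leq \tfrac23\Delta_{\max}(D)+2,\qquad\text{and}\qquad \vec{\chi}(D)\leq \tfrac{\sqrt2}{2}\tilde{\Delta}(D)+2 .$$
   Context: Digraphs are finite, without loops and without parallel arcs (two opposite arcs $uv$ and $vu$ are allowed in general and form a digon). An oriented graph is a digraph with no digon. The underlying graph of $D$ is the undirected simple graph on $V(D)$ in which $uv$ is an edge if and only if $uv$ or $vu$ is an arc of $D$; $\Delta(G)$ is the maximum degree of a graph $G$. For a vertex $v$, $d^+(v)$ and $d^-(v)$ are its out-degree and in-degree. Set $\Delta_{\max}(D)=\max_{v\in V(D)}\max(d^+(v),d^-(v))$ and $\tilde{\Delta}(D)=\max_{v\in V(D)}\sqrt{d^+(v)\cdot d^-(v)}$. The dichromatic number $\vec{\chi}(D)$ is the least $k$ such that $V(D)$ can be partitioned into $k$ (possibly empty) sets each inducing an acyclic subdigraph of $D$ (i.e. one without directed cycles). *)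

(* Defs.v *)
From mathcomp Require Import all_boot all_order all_algebra.
From mathcomp Require Import boolp reals.

Set Implicit Arguments.
Unset Strict Implicit.
Unset Printing Implicit Defensive.

Import Order.TTheory GRing.Theory Num.Theory.

Record digraph := Digraph {
  vertex :> finType;
  is_arc : rel vertex;
  is_arc_irr : irreflexive is_arc
}.

Record sgraph := SGraph {
  svertex :> finType;
  edge : rel svertex;
  edge_sym : symmetric edge;
  edge_irr : irreflexive edge
}.

Definition oriented (D : digraph) : Prop :=
  forall u v : D, ~~ (is_arc u v && is_arc v u).

Section Underlying.
Variable D : digraph.

Definition underlying_edge : rel D := fun u v => is_arc u v || is_arc v u.

Lemma underlying_sym : symmetric underlying_edge.
Proof. by move=> u v; rewrite /underlying_edge orbC. Qed.

Lemma underlying_irr : irreflexive underlying_edge.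
Proof. by move=> u; rewrite /underlying_edge is_arc_irr. Qed.

Definition underlying : sgraph := SGraph underlying_sym underlying_irr.

End Underlying.

Definition degree (G : sgraph) (v : G) : nat := #|[set u | edge v u]|.

Definition max_degree (G : sgraph) : nat := \max_(v : G) degree v.

Definition outdeg (D : digraph) (v : D) : nat := #|[set u | is_arc v u]|.

Definition indeg (D : digraph) (v : D) : nat := #|[set u | is_arc u v]|.

Definition Delta_max (D : digraph) : nat :=
  \max_(v : D) maxn (outdeg v) (indeg v).

(* The terms are nonnegative, so the default value 0 only matters when D has
   no vertex. *)
Definition Delta_tilde (R : realType) (D : digraph) : R :=
  (\big[Num.max/0]_(v : D) Num.sqrt ((outdeg v)%:R * (indeg v)%:R))%R.

(* As arcs are irreflexive, a directed cycle has length at least 2; length 2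
   is a digon. *)
Definition dicycle (D : digraph) (s : seq D) : Prop :=
  s <> [::] /\ ucycle (@is_arc D) s.

Definition acyclic (D : digraph) : Prop := forall s : seq D, ~ dicycle s.

Section Induced.
Variables (D : digraph) (A : {set D}).

Definition induced_arc : rel {v : D | v \in A} :=
  fun u v => is_arc (val u) (val v).

Lemma induced_irr : irreflexive induced_arc.
Proof. by move=> u; rewrite /induced_arc is_arc_irr. Qed.

Definition induced : digraph := Digraph induced_irr.

End Induced.

(* A partition into k possibly empty parts is given by the map sending each
   vertex to the index of its part. *)
Definition dicolorable (D : digraph) (k : nat) : Prop :=
  exists c : D -> 'I_k, forall i : 'I_k, acyclic (induced [set v | c v == i]).

Lemma dicolorable_card (D : digraph) : dicolorable D #|D|.
Proof.
exists (@enum_rank D) => i [|x s] [] //= _ /andP[].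
case: s => [|y s]; first by rewrite /= /induced_arc is_arc_irr.
move=> _ /=/andP[+ _]; rewrite inE => /norP[/eqP + _]; case.
apply: val_inj; apply: (@enum_rank_inj D).
have := valP x; have := valP y; rewrite !inE.
by move=> /eqP -> /eqP ->.
Qed.

Lemma dicolorable_ex (D : digraph) : exists k, `[< dicolorable D k >].
Proof. by exists #|D|; apply/asboolP/dicolorable_card. Qed.

Definition dichromatic (D : digraph) : nat := ex_minn (dicolorable_ex D).

(* Main.v *)
Require Import Defs.
From mathcomp Require Import all_boot all_order all_algebra.
From mathcomp Require Import boolp reals.
From mathcomp Require Import zify lra.

(** The heart of the matter is that an oriented graph of underlying degree at
most 5 has dichromatic number at most 2 ([two_coloring_degree5]).  Granting
this, minimizing the number of monochromatic edges over the maps to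
[Delta / 6 + 1] parts gives parts of inner degree at most 5
([degree_partition], an argument of Lovasz); two colors in each part make
[2 * (Delta / 6 + 1) <= Delta / 3 + 2] colors.  This is the first bound, and
the second one follows since [Delta <= 2 * Delta_max].  For the third one, a
vertex with fewer than [k] out-neighbors (or in-neighbors) can be colored last
with one of [k] colors ([coloring_extend]), so one may assume that all in- and
out-degrees are at least [k].  If moreover their products are less than
[2 (k - 1)^2] then their sums are at most [3 k - 4], and the count above yields
[k] colors.

In an oriented graph of degree at most 5, every vertex has at most two
out-neighbors or at most two in-neighbors; let [N v] be such a small side.
A color class is acyclic as soon as each nonempty set [B] inside it has a
vertex [v] with [N v] disjoint from [B], i.e., as soon as it is acyclic in the
digraph with arcs from [v] to the elements of [N v].  That digraph has
out-degree at most 2, and its digons join only vertices of different sides,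
since a digon between vertices of the same side would be a digon of the
oriented graph.  So the claim reduces to a form of the directed Brooks theorem
for two colors ([two_coloring]), where the side condition rules out the only
obstruction, a bidirected odd cycle.

To prove [two_coloring], take a minimal uncolorable vertex set [S].  For a
coloring of [S] minus a vertex (the hole), the hole has exactly one successor
of each color, and may be filled with a color [b] if its successor of color
[b] becomes the new hole.  Filling the holes with alternating colors, the hole
ends up running around a cycle [x 0, ..., x (L - 1)] of odd length [L], and
each vertex of the cycle changes color at each round.  Comparing the colorings
one round apart shows that the other successor of [x m] is on the cycle too,
at an even distance [d m] ahead of [x m].  That the hole cannot be filled for
free means that the jumps [d] starting from [m] land exactly on [m + L - 1]
([chord_hits]).  This forces [d] to be constant and to divide [L - 1]
([chord_const], [chord_div]).  If [d = L - 1] the cycle is bidirected,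
contradicting the alternation of the sides ([cycle_digons]).  Otherwise
[2 d < L], and cutting the cycle into two intervals of almost equal lengths
yields a coloring ([cycle_coloring]). *)

Set Implicit Arguments.
Unset Strict Implicit.
Unset Printing Implicit Defensive.

(** * Colorings without monochromatic obstructions *)

Definition no_monochromatic (T : finType) (C : Type) (P : pred {set T}) (A : {set T})
    (f : T -> C) : Prop :=
  forall B : {set T}, B \subset A -> P B -> ~ {in B &, forall u v, f u = f v}.

(** The sets [B] in which one can walk forever along [N].  Forbidding them
inside color classes is acyclicity of the classes, in a form that does not
mention cycles. *)
Definition trap (T : finType) (N : T -> {set T}) : pred {set T} :=
  fun B => (B != set0) && [forall v in B, [exists u in B, u \in N v]].

Lemma trapP (T : finType) (N : T -> {set T}) (B : {set T}) :
  trap N B -> forall v, v \in B -> exists2 u, u \in B & u \in N v.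
Proof. by move=> /andP[_ /forall_inP tB] v /tB/exists_inP. Qed.

Definition recolor (T : eqType) (C : Type) (c : T -> C) (x : T) (b : C) : T -> C :=
  fun v => if v == x then b else c v.

(** * Moving the hole of a coloring *)

Section Hole.
Variables (T : finType) (N : T -> {set T}) (S : {set T}).
Hypothesis N_le2 : forall v, #|N v| <= 2.
Hypothesis N_irr : forall v, v \notin N v.
Hypothesis S_bad : forall c : T -> bool, ~ no_monochromatic (trap N) S c.

Definition hole_coloring (x : T) (c : T -> bool) : Prop :=
  x \in S /\ no_monochromatic (trap N) (S :\ x) c.

(** Filling the hole with the color [b] does not give a coloring of [S], so it
must create a monochromatic trap through the hole. *)
Lemma hole_trap x c b : hole_coloring x c ->
  exists B : {set T}, [/\ x \in B, B \subset S, trap N B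
    & {in B, forall v, v != x -> c v = b}].
Proof.
move=> [xS xc]; apply: contrapT => noB.
apply: (S_bad (c := recolor c x b)) => B BS tB Bc.
have [xB|xB] := boolP (x \in B).
  apply: noB; exists B; split=> // v vB vx.
  by have := Bc v x vB xB; rewrite /recolor eqxx (negPf vx).
apply: (xc B) => //; first by rewrite subsetD1 BS.
move=> u v uB vB; have := Bc u v uB vB; rewrite /recolor.
have /negPf-> : u != x by apply: contraNneq xB => <-.
by have /negPf-> : v != x by apply: contraNneq xB => <-.
Qed.

Lemma hole_next x c b : hole_coloring x c ->
  exists u, [/\ u \in N x, u \in S & c u = b].
Proof.
move=> /(hole_trap b)[B [xB /subsetP BS tB Bc]].
have [u uB uN] := trapP tB xB; exists u; split=> //; first exact: BS.
by apply: Bc => //; apply: contraTneq uN => ->.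
Qed.

(** By [hole_next] both colors occur in [N x], which has at most two elements. *)
Lemma hole_next_uniq x c u v : hole_coloring x c ->
  u \in N x -> v \in N x -> c u = c v -> u = v.
Proof.
move=> xc uN vN cuv; apply/eqP; apply/negPn/negP => uv.
have [w [wN _ cw]] := hole_next (~~ c u) xc.
have /subset_leq_card : [set u; v; w] \subset N x.
  by apply/subsetP=> z; rewrite !inE -orbA => /or3P[] /eqP->.
suff -> : #|[set u; v; w]| = 3 by move=> /leq_trans/(_ (N_le2 x)).
rewrite setUC cardsU1 cards2 uv !inE negb_or.
have /negPf-> : w != u by apply/eqP=> wu; move: cw; rewrite wu; case: (c u).
have /negPf-> // : w != v.
by apply/eqP=> wu; move: cw; rewrite wu cuv; case: (c v).
Qed.

(** After the exchange of [x] and [u], no trap of the color of [u] contains [x]: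
the only successor of [x] of that color was [u]. *)
Lemma hole_step x c u : hole_coloring x c -> u \in N x -> u \in S ->
  hole_coloring u (recolor c x (c u)).
Proof.
move=> xc uN uS; split=> // B BSu tB Bc.
have [BS uB] : B \subset S /\ u \notin B by move: BSu; rewrite subsetD1 => /andP.
have [xB|xB] := boolP (x \in B).
  have [w wB wN] := trapP tB xB; have := Bc w x wB xB; rewrite /recolor eqxx.
  have /negPf-> : w != x by apply: contraTneq wN => ->.
  by move/(hole_next_uniq xc wN uN) => wu; rewrite wu (negPf uB) in wB.
case: xc => _ /(_ B); apply=> //; first by rewrite subsetD1 BS.
move=> v w vB wB; have := Bc v w vB wB; rewrite /recolor.
have /negPf-> : v != x by apply: contraNneq xB => <-.
by have /negPf-> : w != x by apply: contraNneq xB => <-.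
Qed.

(** At time [n] the hole [x n] is filled with the color [b (+) odd n], and the
hole moves to the successor of [x n] which had that color. *)
Definition alternating_walk (b : bool) (x : nat -> T) (c : nat -> T -> bool) :=
  forall n, [/\ hole_coloring (x n) (c n), x n.+1 \in N (x n),
    c n (x n.+1) = b (+) odd n
    & forall v, c n.+1 v = recolor (c n) (x n) (b (+) odd n) v].

Lemma alternating_walk_shift b x c i : alternating_walk b x c ->
  alternating_walk (b (+) odd i) (fun n => x (i + n)) (fun n => c (i + n)).
Proof. by move=> w n; rewrite -addbA -oddD addnS; apply: w. Qed.

Lemma alternating_walk_exists x0 c0 : hole_coloring x0 c0 ->
  exists x c, alternating_walk false x c.
Proof.
move=> xc0.
pose nxt (s : T * (T -> bool)) b :=
  (odflt s.1 [pick u in N s.1 :&: S | s.2 u == b], recolor s.2 s.1 b).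
pose w := fix w n := if n is n'.+1 then nxt (w n') (odd n') else (x0, c0).
have nxtP s b : hole_coloring s.1 s.2 ->
    [/\ (nxt s b).1 \in N s.1, (nxt s b).1 \in S & s.2 (nxt s b).1 = b].
  move=> hs; rewrite /nxt /=; case: pickP => [u|none] /=.
    by rewrite inE => /andP[/andP[? ?] /eqP].
  have [u [uN uS cu]] := hole_next b hs.
  by have := none u; rewrite inE uN uS cu eqxx.
have wP n : hole_coloring (w n).1 (w n).2.
  elim: n => //= n IHn; have [uN uS cu] := nxtP (w n) (odd n) IHn.
  by have := hole_step IHn uN uS; rewrite cu.
exists (fun n => (w n).1), (fun n => (w n).2) => n.
by have [uN _ cu] := nxtP (w n) (odd n) (wP n); split.
Qed.

(** The walk is cut at the first return of the hole to an earlier position, and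
restarted from that position. *)
Lemma alternating_walk_closed x0 c0 : hole_coloring x0 c0 ->
  exists b x c L, [/\ alternating_walk b x c, 0 < L, x L = x 0
    & forall i j, i < L -> j < L -> x i = x j -> i = j].
Proof.
move=> /alternating_walk_exists[x [c w]].
have ex : exists n, ~~ uniq (mkseq x n.+1).
  exists #|T|; apply/negP => /card_uniqP; rewrite size_mkseq => E.
  by have := max_card [in mkseq x #|T|.+1]; rewrite E ltnn.
case: (ex_minnP ex) => n; rewrite -addn1 /mkseq iotaD map_cat cats1 rcons_uniq.
rewrite negb_and negbK add0n => xn min_n.
have un : uniq (mkseq x n).
  by case: n min_n {xn} => // n min_n; apply: contraT => /min_n; rewrite ltnn.
move: xn; rewrite -/(mkseq x n) un orbF => /mapP[i]; rewrite mem_iota => /= lt_in xni.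
have ixn : x n = x i := xni.
exists (false (+) odd i), (fun m => x (i + m)), (fun m => c (i + m)), (n - i).
split; [exact: alternating_walk_shift | by rewrite subn_gt0
       | by rewrite addn0 subnKC // ltnW | ].
move=> j k jL kL E; apply/eqP; rewrite -(eqn_add2l i).
have jn : i + j < n by lia.
have kn : i + k < n by lia.
by rewrite -(nth_uniq (x 0) _ _ un) ?size_mkseq // !nth_mkseq // E.
Qed.

End Hole.

(** * The hole runs around an odd cycle *)

Section ClosedWalk.
Variables (T : finType) (N : T -> {set T}) (S : {set T}).
Hypothesis N_le2 : forall v, #|N v| <= 2.
Hypothesis N_irr : forall v, v \notin N v.
Hypothesis S_bad : forall c : T -> bool, ~ no_monochromatic (trap N) S c.
Variables (b : bool) (x : nat -> T) (c : nat -> T -> bool) (L : nat).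
Hypothesis walk : alternating_walk N S b x c.
Hypothesis L_gt0 : 0 < L.
Hypothesis xL : x L = x 0.
Hypothesis x_inj : forall i j, i < L -> j < L -> x i = x j -> i = j.

Let hole n : hole_coloring N S (x n) (c n). Proof. by case: (walk n). Qed.
Let xN n : x n.+1 \in N (x n). Proof. by case: (walk n). Qed.
Let cx n : c n (x n.+1) = b (+) odd n. Proof. by case: (walk n). Qed.
Let cS n v : c n.+1 v = recolor (c n) (x n) (b (+) odd n) v.
Proof. by case: (walk n). Qed.

(** A vertex keeps the color received when the hole left it until the hole comes
back. *)
Lemma walk_color j n : (forall t, j < t < j.+1 + n -> x t != x j) ->
  c (j.+1 + n) (x j) = b (+) odd j.
Proof.
elim: n => [|n IHn] away; first by rewrite addn0 cS /recolor eqxx.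
rewrite addnS cS /recolor eq_sym.
have /negPf-> : x (j.+1 + n) != x j by apply: away; lia.
by apply: IHn => t jt; apply: away; lia.
Qed.

Lemma walk_color_change m n v : c (m + n) v != c m v ->
  exists2 j, j < n & x (m + j) = v.
Proof.
elim: n => [|n IHn]; first by rewrite addn0 eqxx.
rewrite addnS cS /recolor; case: (v =P _) => [-> _|_ /IHn[j jn xj]]; first by exists n.
by exists j => //; apply: ltnW.
Qed.

Lemma length_gt1 : 1 < L.
Proof.
rewrite ltn_neqAle L_gt0 andbT; apply/eqP => L1.
by have := xN 0; rewrite L1 xL (negPf (N_irr _)).
Qed.

(** The vertex [x 0] received the color [b] at time [0], and has the color used
at time [L - 1] when the hole comes back to it. *)
Lemma length_odd : odd L.
Proof.
have L1 := length_gt1.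
have := cx L.-1; rewrite prednK // xL.
have -> : L.-1 = 1 + (L - 2) by lia.
rewrite walk_color; last first.
  move=> t tL; apply/eqP => /x_inj E.
  have t0 : t = 0 by apply: E; lia.
  lia.
move/addbI; lia.
Qed.

(** When the hole is back at [x m], the vertex [x m.+1] has the color given to it
one round earlier.  As [L] is odd this is the color that is used now, so the
hole moves to [x m.+1] again. *)
Lemma walk_mod n : x n = x (n %% L).
Proof.
have L1 := length_gt1; have Lo := length_odd.
elim/ltn_ind: n => n IHn.
have [nL|] := ltnP n L; first by rewrite modn_small.
rewrite leq_eqVlt => /predU1P[<-|Ln]; first by rewrite modnn.
have {Ln} [m nm] : exists m, n = (m + L).+1 by exists (n - L.+1); lia.
subst n.
have xmL : x (m + L) = x m by rewrite IHn // modnDr -IHn //; lia.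
have -> : (m + L).+1 %% L = m.+1 %% L by rewrite -addSn modnDr.
rewrite -IHn; last by lia.
have xN' := xN (m + L).
apply: (hole_next_uniq N_le2 N_irr S_bad (hole (m + L))) => //; first by rewrite xmL.
have -> : c (m + L) (x m.+1) = b (+) odd m.+1.
  have -> : m + L = m.+2 + (L - 2) by lia.
  apply: walk_color => t tL; apply/eqP; rewrite (IHn t) ?(IHn m.+1); [|lia..].
  move/x_inj; rewrite !ltn_mod => /(_ L_gt0 L_gt0)/eqP.
  rewrite eqn_mod_dvd; last by lia.
  by apply/negP; rewrite gtnNdvd //; lia.
by rewrite cx oddD Lo /= addbT.
Qed.

Lemma walk_periodic n : x (n + L) = x n.
Proof. by rewrite walk_mod modnDr -walk_mod. Qed.

Lemma walk_inj m i j : i < L -> j < L -> x (m + i) = x (m + j) -> i = j.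
Proof.
move=> iL jL; rewrite (walk_mod (m + i)) (walk_mod (m + j)).
move/x_inj; rewrite !ltn_mod => /(_ L_gt0 L_gt0)/eqP.
by rewrite eqn_modDl !modn_small // => /eqP.
Qed.

Lemma walk_alternates m j : 0 < j < L -> c (m + L) (x (m + j)) = b (+) odd (m + j).
Proof.
move=> jL; have -> : m + L = (m + j).+1 + (L - j.+1) by lia.
apply: walk_color => t tL; apply/eqP.
have -> : t = m + (t - m) by lia.
by move/walk_inj; lia.
Qed.

(** Between the times [m] and [m + L] the successor [x m.+1] of the hole [x m]
changes color, hence so does the other successor.  So the hole visits the
latter in between; and the color that it has then gives the parity of [d]. *)
Lemma walk_chord_exists m : exists d,
  [/\ 0 < d < L, ~~ odd d, x (m + d) \in N (x m)
    & forall y, y \in N (x m) -> y \in S -> y = x m.+1 \/ y = x (m + d)].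
Proof.
have L1 := length_gt1; have Lo := length_odd.
have hm : hole_coloring N S (x m) (c (m + L)) by rewrite -(walk_periodic m).
have [q [qN qS cq]] := hole_next N_irr S_bad (~~ (b (+) odd m)) (hole m).
have qx1 : q != x m.+1.
  by apply/eqP=> E; move: cq; rewrite E cx; case: (b (+) odd m).
have cx1 : c (m + L) (x m.+1) = ~~ (b (+) odd m).
  by rewrite -addn1 walk_alternates // addn1 addbN.
have cqL : c (m + L) q = b (+) odd m.
  apply: contraNeq qx1 => cqL; apply/eqP.
  apply: (hole_next_uniq N_le2 N_irr S_bad hm qN (xN m)); rewrite cx1.
  by case: (c _ q) cqL; case: (b (+) odd m).
have [|d dL xd] := @walk_color_change m L q.
  by rewrite cqL cq; case: (b (+) odd m).
have d_gt0 : 0 < d.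
  rewrite lt0n; apply/eqP => d0; move: xd; rewrite d0 addn0 => xm.
  by rewrite -xm (negPf (N_irr _)) in qN.
exists d; rewrite d_gt0 dL xd; split=> //.
  move: cqL; rewrite -xd walk_alternates ?d_gt0 // oddD addbA.
  by case: (odd d); case: (b (+) odd m).
move=> y yN yS.
have [cy|cy] := eqVneq (c (m + L) y) (c (m + L) q).
  by right; apply: (hole_next_uniq N_le2 N_irr S_bad hm yN qN).
left; apply: (hole_next_uniq N_le2 N_irr S_bad hm yN (xN m)).
by move: cy; rewrite cqL cx1; case: (c _ y); case: (b (+) odd m).
Qed.

(** * The second successors on the cycle *)

Variable d : nat -> nat.
Hypothesis d_lt : forall m, 0 < d m < L.
Hypothesis d_even : forall m, ~~ odd (d m).
Hypothesis d_N : forall m, x (m + d m) \in N (x m).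
Hypothesis d_only : forall m y, y \in N (x m) -> y \in S ->
  y = x m.+1 \/ y = x (m + d m).

Let xS n : x n \in S. Proof. by case: (hole n). Qed.

Lemma chord_periodic m : d (m + L) = d m.
Proof.
have L1 := length_gt1.
have [dL dm] := (d_lt (m + L), d_lt m).
have : x (m + L + d (m + L)) \in N (x m) by rewrite -(walk_periodic m).
have -> : m + L + d (m + L) = m + d (m + L) + L by lia.
rewrite walk_periodic => /d_only/(_ (xS _)).
case; last by apply: walk_inj; lia.
rewrite -addn1 => /walk_inj E; have := d_even (m + L).
by rewrite E; lia.
Qed.

(** Consider a trap through the hole [x m] at time [m + L], in the color class of
the vertices at even distance ahead of [x m].  From each of its vertices the
trap continues along a jump that does not pass over [x m], because passing
over it would change the parity of the distance; the only other way on is the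
arc from [x (m + L - 1)] to [x m]. *)
Lemma chord_hits m : exists k, iter k (fun j => j + d j) m = m + L.-1.
Proof.
have L1 := length_gt1; have Lo := length_odd.
have hm : hole_coloring N S (x m) (c (m + L)) by rewrite -(walk_periodic m).
have [B [xB /subsetP BS tB Bc]] := hole_trap S_bad (b (+) odd m) hm.
have Beven j : 0 < j < L -> x (m + j) \in B -> ~~ odd j.
  move=> jL jB; have := Bc _ jB; rewrite walk_alternates // oddD addbA.
  have -> : x (m + j) != x m.
    by rewrite -[in x m](addn0 m); apply/eqP => /walk_inj; lia.
  by move/(_ isT); case: (odd j); case: (b (+) odd m).
(* Induction on the distance [n] which remains to be covered. *)
suff hit n e : e + n = L.-1 -> ~~ odd e -> x (m + e) \in B ->
    exists k, iter k (fun j => j + d j) (m + e) = m + L.-1.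
  by rewrite -{1}(addn0 m); apply: (hit L.-1); rewrite ?addn0.
elim/ltn_ind: n e => n IHn e en eo eB.
have [n0|n_gt0] := posnP n; first by exists 0; rewrite /= -en n0 addn0.
have [u uB uN] := trapP tB eB.
have [de dodd] := (d_lt (m + e), d_even (m + e)).
have [uE|uE] := d_only uN (BS _ uB); rewrite {}uE in uB.
  have : ~~ odd e.+1 by apply: Beven; rewrite ?addnS //; lia.
  by rewrite /= negbK (negPf eo).
have [lt_eL|le_Le] := ltnP (e + d (m + e)) L.
  have [||||k kE] := IHn (n - d (m + e)) _ (e + d (m + e)); [lia | lia | | |].
  - by rewrite oddD (negPf eo).
  - by rewrite addnA.
  by exists k.+1; rewrite iterSr -addnA.
have /negP[] : ~~ odd (e + d (m + e) - L).
  apply: Beven; last first.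
    by rewrite -walk_periodic -addnA subnK // addnA.
  by lia.
lia.
Qed.

(** Jumping from [m], one arrives at [m + L - 1], whence the next jump has length
[d (m + L - 1)].  But jumping from [m + d m], one goes through the same points
and must land on [m + d m + L - 1], so this next jump cannot go further. *)
Lemma chord_le m : d (m + L.-1) <= d m.
Proof.
have L1 := length_gt1.
pose g j := j + d j.
have mono k l j : k <= l -> iter k g j <= iter l g j.
  move=> kl; rewrite -(subnK kl) iterD; move: (iter k g j) => {}j.
  elim: (l - k) => //= n /leq_trans; apply; exact: leq_addr.
have [r rE] := chord_hits m; have [k kE] := chord_hits (g m).
case: r rE => [/=|r]; first by lia.
rewrite iterSr -/g -/(g m) => rE.
have /(mono _ _ (g m)) : r < k.
  rewrite ltnNge; apply/negP => /(mono _ _ (g m)).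
  by rewrite rE kE /g; have := d_lt m; lia.
by rewrite /= rE kE /g; lia.
Qed.

(** Modulo [L] the inequality [chord_le] compares neighbors, so [d] is monotone;
and it is periodic. *)
Lemma chord_const m : d m = d 0.
Proof.
have L1 := length_gt1.
have step n : d n <= d n.+1.
  by have := chord_le n.+1; rewrite addSnnS prednK // chord_periodic.
have mono n k : d n <= d (n + k).
  by elim: k => [|k IHk]; rewrite ?addn0 // addnS (leq_trans IHk).
have per k : d (k * L) = d 0.
  by elim: k => // k IHk; rewrite mulSn addnC chord_periodic.
apply/eqP; rewrite eqn_leq (mono 0) andbT -(per m) -(subnKC (_ : m <= m * L)) //.
by rewrite leq_pmulr.
Qed.

Lemma chord_div : exists k, k * d 0 = L.-1.
Proof.
have [k kE] := chord_hits 0; exists k; rewrite -[RHS]add0n -kE.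
by elim: k {kE} => //= k <-; rewrite chord_const mulSn addnC.
Qed.

(** Each half of the cycle is traversed forward by the arcs of the cycle, and
also by the jumps, since these are too short for a jump which passes over
[x 0] to end in the half where it started.  No arc leads from the cycle to the
rest of [S], so any coloring of the rest is compatible. *)
Lemma cycle_coloring : 2 * d 0 < L ->
  (exists c' : T -> bool,
     no_monochromatic (trap N) (S :\: [set x i | i : 'I_L]) c') ->
  exists c' : T -> bool, no_monochromatic (trap N) S c'.
Proof.
move=> dL [c' c'P].
have L1 := length_gt1; have Lo := length_odd; have d0 := d_lt 0.
set O := [set _ | _ : _] in c'P.
pose low v := [exists i : 'I_L, (x i == v) && (i <= L./2)].
have lowE i : i < L -> low (x i) = (i <= L./2).
  move=> iL; apply/existsP/idP => [[j /andP[/eqP/x_inj E jL]]|iL2].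
    by rewrite -E.
  by exists (Ordinal iL); rewrite eqxx.
have xO i : i < L -> x i \in O by move=> iL; apply/imsetP; exists (Ordinal iL).
exists (fun v => if v \in O then low v else c' v) => B BS tB Bc.
have [BO|[v vBO]] := set_0Vmem (B :&: O).
  apply: (c'P B) => //.
    by rewrite subsetD BS -setI_eq0 BO eqxx.
  have nO w : w \in B -> (w \in O) = false.
    by move=> wB; apply/negP=> wO; have := in_set0 w; rewrite -BO inE wB wO.
  by move=> u w uB wB; have := Bc u w uB wB; rewrite !nO.
move: vBO; rewrite inE => /andP[vB /imsetP[i0 _ vE]].
have exB : exists i, (i < L) && (x i \in B) by exists i0; rewrite ltn_ord -vE.
have bB i : (i < L) && (x i \in B) -> i <= L by move=> /andP[/ltnW].
(* From the last vertex of the trap on the cycle, an arc must go backwards. *)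
case: (ex_maxnP exB bB) => i /andP[iL iB] imax.
have [u uB uN] := trapP tB iB.
have same j : j < L -> x j \in B -> (j <= L./2) = (i <= L./2).
  move=> jL jB; have := Bc (x j) (x i) jB iB.
  by rewrite !xO // !lowE.
have [uE|uE] := d_only uN (subsetP BS _ uB); rewrite {}uE in uB.
  have [lt_i|] := ltnP i.+1 L.
    by have := imax i.+1; rewrite lt_i uB => /(_ isT); rewrite ltnn.
  move=> Li; have iL' : i.+1 = L by lia.
  by rewrite iL' xL in uB; have := same 0 L_gt0 uB; lia.
rewrite chord_const in uB.
have [lt_i|Li] := ltnP (i + d 0) L.
  by have := imax (i + d 0); rewrite lt_i uB => /(_ isT); lia.
have E : x (i + d 0 - L) = x (i + d 0) by rewrite -walk_periodic subnK.
by rewrite -E in uB; have := same _ _ uB; lia.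
Qed.

Lemma cycle_digons (side : T -> bool) :
  (forall u v, u \in N v -> v \in N u -> side u != side v) -> d 0 != L.-1.
Proof.
move=> sideN; apply/eqP => dL.
have L1 := length_gt1; have Lo := length_odd.
have sd n : side (x n) = side (x 0) (+) odd n.
  elim: n => [|n IHn]; first by rewrite addbF.
  have : x n \in N (x n.+1).
    by have := d_N n.+1; rewrite chord_const dL addSnnS prednK // walk_periodic.
  move/(sideN _ _ (xN n)); rewrite IHn /=.
  by case: (side _); case: (side _); case: (odd n).
by have := sd L; rewrite xL Lo; case: (side _).
Qed.

End ClosedWalk.

(** * A directed Brooks theorem for two colors *)

(** An uncolorable set of least size has colorings with a hole, so it contains
the cycle studied above; both possible values of the jump length fail. *)
Lemma two_coloring (T : finType) (N : T -> {set T}) (side : T -> bool) :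
    (forall v, #|N v| <= 2) -> (forall v, v \notin N v) ->
    (forall u v, u \in N v -> v \in N u -> side u != side v) ->
  exists c : T -> bool, no_monochromatic (trap N) setT c.
Proof.
move=> N2 Nirr sideN; move: [set: T] => S.
have [n] := ubnP #|S|; elim: n S => // n IHn S Sn.
have [->|[x0 x0S]] := set_0Vmem S.
  exists xpredT => B; rewrite subset0 => /eqP-> /andP[]; by rewrite eqxx.
apply: contrapT => noc.
have Sbad (c : T -> bool) : ~ no_monochromatic (trap N) S c.
  by move=> cP; apply: noc; exists c.
have [c0 c0P] : exists c : T -> bool, no_monochromatic (trap N) (S :\ x0) c.
  by apply: IHn; move: Sn; rewrite (cardsD1 x0 S) x0S.
have [b [x [c [L [w L0 xL xinj]]]]] :=
  alternating_walk_closed N2 Nirr Sbad (conj x0S c0P).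
have /choice[d dP] := walk_chord_exists N2 Nirr Sbad w L0 xL xinj.
have dlt m : 0 < d m < L by case: (dP m).
have deven m : ~~ odd (d m) by case: (dP m).
have dN m : x (m + d m) \in N (x m) by case: (dP m).
have donly m y : y \in N (x m) -> y \in S -> y = x m.+1 \/ y = x (m + d m).
  by case: (dP m) => _ _ _; apply.
have [k kd] := chord_div N2 Nirr Sbad w L0 xL xinj dlt deven dN donly.
have /eqP dL := cycle_digons N2 Nirr Sbad w L0 xL xinj dlt deven dN donly sideN.
apply: noc.
apply: (cycle_coloring N2 Nirr Sbad w L0 xL xinj dlt deven dN donly).
  case: k kd => [|[|k]]; have := dlt 0; rewrite ?mulSn; lia.
apply: IHn; apply: (@leq_trans #|S|); last by rewrite -ltnS.
apply: (@leq_ltn_trans #|S :\ x 0|).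
  apply/subset_leq_card/subsetP => v; rewrite !inE => /andP[vO ->]; rewrite andbT.
  apply: contraNneq vO => ->; apply/imsetP; by exists (Ordinal L0).
by have [[xS _] _ _ _] := w 0; rewrite (cardsD1 (x 0) S) xS.
Qed.

(** * Partitions with small inner degrees *)

Section Lovasz.
Variables (T : finType) (e : rel T).
Hypotheses (e_sym : symmetric e) (e_irr : irreflexive e).

(** In a partition with the fewest edges inside parts, a vertex with [r]
neighbors in its own part could be moved to a part where it has fewer. *)
Lemma degree_partition p r :
    (forall v, #|[set u | e v u]| < p * r) -> 0 < p ->
  exists f : T -> 'I_p, forall v, #|[set u | e v u && (f u == f v)]| < r.
Proof.
case: p => // p deg _.
pose F (f : {ffun T -> 'I_p.+1}) x y : nat := e x y && (f x == f y).
pose E f := \sum_x \sum_y F f x y.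
case: (arg_minnP E (isT : predT [ffun _ : T => ord0 : 'I_p.+1])) => f _ fmin.
exists f => v; rewrite ltnNge; apply/negP => own_ge.
have own g j : \sum_(y | y != v) (e v y && (g y == j) : nat)
    = #|[set u | e v u && (g u == j :> 'I_p.+1)]|.
  rewrite -sum1dep_card big_mkcond [in RHS]big_mkcond /=.
  apply: eq_bigr => y _; case: eqVneq => [->|_]; first by rewrite e_irr.
  by case: andP.
have [j jr] : exists j, #|[set u | e v u && (f u == j)]| < r.
  apply: contrapT => all_ge; have := deg v.
  rewrite -sum1dep_card (partition_big f xpredT) //= ltnNge => /negP; apply.
  rewrite -[X in X * r]card_ord -sum_nat_const; apply: leq_sum => j _.
  by rewrite sum1dep_card leqNgt; apply/negP => jr; apply: all_ge; exists j.
(* The edges at [v] are counted twice, and only these depend on the color of [v]. *)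
have Esplit (g : {ffun T -> 'I_p.+1}) :
    E g = 2 * #|[set u | e v u && (g u == g v)]|
          + \sum_(x | x != v) \sum_(y | y != v) F g x y.
  have col : \sum_(x | x != v) F g x v = #|[set u | e v u && (g u == g v)]|.
    by rewrite -own; apply: eq_bigr => x _; rewrite /F e_sym.
  have row : \sum_y F g v y = #|[set u | e v u && (g u == g v)]|.
    rewrite -own (bigD1 v) //= {1}/F e_irr add0n.
    by apply: eq_bigr => y _; rewrite /F eq_sym.
  rewrite /E (bigD1 v) //= row.
  under eq_bigr => x _ do rewrite (bigD1 v) //=.
  by rewrite big_split /= col addnA addnn -mul2n.
pose g := [ffun x => if x == v then j else f x].
have := fmin g isT; rewrite leqNgt => /negP; apply.
rewrite !Esplit.
have -> : \sum_(x | x != v) \sum_(y | y != v) F g x y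
        = \sum_(x | x != v) \sum_(y | y != v) F f x y.
  apply: eq_bigr => x /negPf xv; apply: eq_bigr => y /negPf yv.
  by rewrite /F !ffunE xv yv.
have -> : #|[set u | e v u && (g u == g v)]| = #|[set u | e v u && (f u == j)]|.
  rewrite -!own; apply: eq_bigr => y /negPf yv.
  by rewrite !ffunE yv eqxx.
by rewrite ltn_add2r ltn_mul2l /=; apply: leq_trans own_ge.
Qed.

End Lovasz.

(** * Two colors suffice for degree at most five *)

(** The vertex set of a directed cycle has this property, so its absence from
color classes implies acyclicity.  It is symmetric under reversal of the arcs,
which allows in- and out-neighbors to be treated alike. *)
Definition circular (T : finType) (a : rel T) : pred {set T} :=
  fun B => (B != set0) &&
    [forall v in B, [exists u in B, a v u] && [exists u in B, a u v]].

Lemma circularP (T : finType) (a : rel T) (B : {set T}) v :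
  circular a B -> v \in B ->
  (exists2 u, u \in B & a v u) /\ (exists2 u, u \in B & a u v).
Proof.
by move=> /andP[_ /forall_inP cB] /cB /andP[/exists_inP ? /exists_inP ?].
Qed.

Section Digraph.
Variables (T : finType) (a : rel T).
Hypotheses (a_irr : irreflexive a) (a_oriented : forall u v, ~~ (a u v && a v u)).

Definition nbr : rel T := fun u v => a u v || a v u.

Lemma card_nbr (A : {set T}) v :
  #|[set u in A | nbr v u]| = #|[set u in A | a v u]| + #|[set u in A | a u v]|.
Proof.
rewrite -cardsUI.
have -> : [set u in A | a v u] :&: [set u in A | a u v] = set0.
  apply/setP=> u; rewrite !inE; apply/negP => /andP[/andP[_ vu] /andP[_ uv]].
  by have := a_oriented u v; rewrite uv vu.
rewrite cards0 addn0; congr #|pred_of_set _|.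
by apply/setP=> u; rewrite !inE andb_orr.
Qed.

Lemma nbr_sym : symmetric nbr.
Proof. by move=> u v; rewrite /nbr orbC. Qed.

Lemma nbr_irr : irreflexive nbr.
Proof. by move=> u; rewrite /nbr a_irr. Qed.

Lemma two_coloring_degree5 : (forall v, #|[set u | nbr v u]| <= 5) ->
  exists c : T -> bool, no_monochromatic (circular a) setT c.
Proof.
move=> deg5.
pose out v := [set u | a v u]; pose in_ v := [set u | a u v].
have deg v : #|out v| + #|in_ v| <= 5.
  have := card_nbr setT v.
  have eqT (P : pred T) : [set u in setT | P u] = [set u | P u].
    by apply/setP=> u; rewrite !inE.
  by rewrite !eqT => <-.
pose side v := #|out v| <= 2.
pose N v := if side v then out v else in_ v.
have [|||c cP] := @two_coloring T N side.
- by move=> v; rewrite /N; case: ifP => //; have := deg v; rewrite /side; lia.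
- by move=> v; rewrite /N; case: ifP; rewrite inE a_irr.
- move=> u v; rewrite /N => uv vu; apply/eqP => E; move: uv vu; rewrite E.
  have /negP no_digon := a_oriented u v.
  by case: ifP => _; rewrite !inE => ? ?; apply: no_digon; apply/andP.
exists c => B BS cB; apply: cP => //.
case/andP: (cB) => B0 _; apply/andP; split=> //.
apply/forall_inP => v vB; have [[u uB vu] [w wB wv]] := circularP cB vB.
apply/exists_inP; rewrite /N; case: ifP => _.
  by exists u; rewrite ?inE.
by exists w; rewrite ?inE.
Qed.
End Digraph.

(** * Colorings from degree bounds *)

Section Coloring.
Variables (T : finType) (a : rel T).
Hypotheses (a_irr : irreflexive a) (a_oriented : forall u v, ~~ (a u v && a v u)).

Lemma no_monochromatic_ord (C : finType) k (S : {set T}) (f : T -> C) : #|C| <= k ->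
    no_monochromatic (circular a) S f ->
  exists g : T -> 'I_k, no_monochromatic (circular a) S g.
Proof.
move=> Ck fP; exists (fun v => widen_ord Ck (enum_rank (f v))) => B BS cB Bg.
apply: (fP B BS cB) => u v uB vB; apply: enum_rank_inj; apply: val_inj.
by have /(congr1 val) := Bg u v uB vB.
Qed.

Lemma coloring_degree d k (S : {set T}) :
    (forall v, v \in S -> #|[set u in S | nbr a v u]| <= d) ->
    2 * (d %/ 6).+1 <= k ->
  exists f : T -> 'I_k, no_monochromatic (circular a) S f.
Proof.
move=> deg dk; pose e u v := [&& u \in S, v \in S & nbr a u v].
have e_sym : symmetric e by move=> u v; rewrite /e nbr_sym andbCA.
have e_irr : irreflexive e by move=> u; rewrite /e nbr_irr // !andbF.
have e_deg v : #|[set u | e v u]| < (d %/ 6).+1 * 6.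
  apply: leq_ltn_trans (ltn_ceil d (isT : 0 < 6)).
  have [vS|/negPf vS] := boolP (v \in S).
    apply: leq_trans (deg v vS); apply/subset_leq_card/subsetP => u.
    by rewrite !inE /e vS.
  have -> : [set u | e v u] = set0 by apply/setP=> u; rewrite !inE /e vS.
  by rewrite cards0.
have [f f5] := degree_partition e_sym e_irr e_deg isT.
(* Two colors are used in the subgraph of the arcs inside the parts. *)
pose a' u v := [&& u \in S, v \in S, f u == f v & a u v].
have [|||c cP] := @two_coloring_degree5 T a'.
- by move=> u; rewrite /a' a_irr !andbF.
- move=> u v; apply: contra (a_oriented u v).
  by move=> /andP[/and4P[_ _ _ ->] /and4P[_ _ _ ->]].
- move=> v; rewrite -ltnS; apply: leq_ltn_trans (f5 v).
  apply/subset_leq_card/subsetP => u; rewrite !inE /e /nbr /a'.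
  by move=> /orP[] /and4P[-> -> /eqP-> ->]; rewrite ?orbT eqxx.
apply: (@no_monochromatic_ord ('I_(d %/ 6).+1 * bool)%type _ _ (fun v => (f v, c v))).
  by rewrite card_prod card_ord card_bool mulnC.
move=> B BS cB Bfc; apply: (cP B (subsetT B)); last first.
  by move=> u v uB vB; case: (Bfc u v uB vB).
case/andP: (cB) => B0 _; apply/andP; split=> //; apply/forall_inP => v vB.
have a'E u w : u \in B -> w \in B -> a u w -> a' u w.
  move=> uB wB auw; rewrite /a' auw !(subsetP BS) //.
  by case: (Bfc u w uB wB) => ->; rewrite eqxx.
have [[u uB vu] [w wB wv]] := circularP cB vB.
by apply/andP; split; apply/exists_inP; [exists u|exists w] => //; apply: a'E.
Qed.

(** Give [v] a color that does not occur on the side [r] of [v] which is small. *)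
Lemma coloring_extend k (S : {set T}) v (f : T -> 'I_k) :
    no_monochromatic (circular a) (S :\ v) f ->
    (#|[set u in S | a v u]| < k) || (#|[set u in S | a u v]| < k) ->
  exists g : T -> 'I_k, no_monochromatic (circular a) S g.
Proof.
move=> fP small.
have [r [rP rk]] : exists r : rel T,
    (forall B, circular a B -> v \in B -> exists2 u, u \in B & (u != v) && r v u)
    /\ #|[set u in S | r v u]| < k.
  have nv u w : a u w -> u != w by apply: contraTneq => ->; rewrite a_irr.
  case/orP: small => [out_k|in_k].
    exists a; split=> // B cB vB; have [[u uB vu] _] := circularP cB vB.
    by exists u; rewrite // vu eq_sym nv.
  exists (fun x y => a y x); split=> // B cB vB.
  by have [_ [u uB uv]] := circularP cB vB; exists u; rewrite // uv nv.
have [i iP] : exists i, i \notin f @: [set u in S | r v u].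
  apply/existsP; rewrite -negb_forall; apply/negP => /forallP all_i.
  have := leq_imset_card f [set u in S | r v u]; rewrite leqNgt => /negP; apply.
  apply: leq_trans rk _; rewrite -[X in X <= _]card_ord.
  by apply/subset_leq_card/subsetP => i _; apply: all_i.
exists (recolor f v i) => B BS cB Bg.
have [vB|vB] := boolP (v \in B).
  have [u uB /andP[uv vu]] := rP B cB vB.
  have := Bg u v uB vB; rewrite /recolor eqxx (negPf uv) => fu.
  by case/negP: iP; rewrite -fu imset_f // inE vu (subsetP BS).
apply: (fP B) => //; first by rewrite subsetD1 BS.
move=> u w uB wB; have := Bg u w uB wB; rewrite /recolor.
have /negPf-> : u != v by apply: contraNneq vB => <-.
by have /negPf-> : w != v by apply: contraNneq vB => <-.
Qed.

(** When no vertex can be left for the end, both degrees [x], [y] of a vertex are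
at least [k], so that [(x - k) (y - k) >= 0]; with [x + y >= 3 k - 3] this would
give [x y >= k (2 k - 3) >= 2 (k - 1)^2]. *)
Lemma coloring_product k :
    1 < k ->
    (forall v, #|[set u | a v u]| * #|[set u | a u v]| < 2 * k.-1 ^ 2) ->
  exists f : T -> 'I_k, no_monochromatic (circular a) setT f.
Proof.
move=> k1 prod; move: [set: T] => S.
have [n] := ubnP #|S|; elim: n S => // n IHn S Sn.
have [/existsP[v /andP[vS small]]|] :=
  boolP [exists v, (v \in S)
    && ((#|[set u in S | a v u]| < k) || (#|[set u in S | a u v]| < k))].
  have [|f fP] := IHn (S :\ v); first by move: Sn; rewrite (cardsD1 v) vS.
  exact: coloring_extend fP small.
rewrite negb_exists => /forallP large.
apply: (@coloring_degree (3 * k - 4)); last by lia.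
move=> v vS; rewrite card_nbr //.
have := large v; rewrite vS negb_or -!leqNgt => /andP[].
have sub (r : rel T) : #|[set u in S | r v u]| <= #|[set u | r v u]|.
  by apply/subset_leq_card/subsetP => u; rewrite !inE => /andP[].
have := leq_mul (sub a) (sub (fun x y => a y x)).
move/leq_ltn_trans/(_ (prod v)).
move: #|_| #|_| => x y xy kx ky; rewrite leqNgt; apply/negP => big.
have [l kl] : exists l, k = l.+2 by exists (k - 2); lia.
subst k; rewrite /= in xy; nia.
Qed.

End Coloring.

(** * The dichromatic number *)

Lemma dichromatic_le (D : digraph) k (f : D -> 'I_k) :
  no_monochromatic (circular (@is_arc D)) setT f -> dichromatic D <= k.
Proof.
move=> fP; rewrite /dichromatic; case: ex_minnP => m _; apply; apply/asboolP.
exists f => i s [s0 /andP[cyc us]].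
pose B := [set val u | u in s].
apply: (fP B (subsetT B)).
  apply/andP; split.
    case: s s0 {cyc us} @B => // u s _ B; apply/set0Pn.
    by exists (val u); apply: imset_f; rewrite inE eqxx.
  apply/forall_inP => _ /imsetP[u us' ->]; apply/andP; split; apply/exists_inP.
    exists (val (next s u)); first by rewrite imset_f ?mem_next.
    exact: (next_cycle cyc us').
  exists (val (prev s u)); first by rewrite imset_f ?mem_prev.
  exact: (prev_cycle cyc us').
move=> _ _ /imsetP[u _ ->] /imsetP[v _ ->].
by have := valP u; have := valP v; rewrite !inE => /eqP-> /eqP->.
Qed.

Import Order.TTheory GRing.Theory Num.Theory.
Local Open Scope ring_scope.

Lemma dichromatic_degree (D : digraph) : oriented D ->
  (dichromatic D <= 2 * (max_degree (underlying D) %/ 6).+1)%N.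
Proof.
move=> hD.
have [v vS||f /dichromatic_le//] := @coloring_degree D (@is_arc D) (@is_arc_irr D) hD
  (max_degree (underlying D)) (2 * (max_degree (underlying D) %/ 6).+1) setT; last by [].
apply: leq_trans (leq_bigmax (F := @degree (underlying D)) v).
by apply/subset_leq_card/subsetP => u; rewrite !inE.
Qed.

Lemma max_degree_le (D : digraph) : oriented D ->
  (max_degree (underlying D) <= 2 * Delta_max D)%N.
Proof.
move=> hD; apply/bigmax_leqP => v _.
have le : (maxn (outdeg v) (indeg v) <= Delta_max D)%N.
  exact: (leq_bigmax (F := fun v : D => maxn (outdeg v) (indeg v))).
have -> : degree (G := underlying D) v = (outdeg v + indeg v)%N.
  have := card_nbr hD setT v.
  have eqT (P : pred D) : [set u in setT | P u] = [set u | P u].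
    by apply/setP=> u; rewrite !inE.
  by rewrite !eqT.
by move: le; rewrite geq_max => /andP[]; lia.
Qed.

Lemma Delta_tilde_ge (R : realType) (D : digraph) (v : D) :
  Num.sqrt ((outdeg v)%:R * (indeg v)%:R) <= Delta_tilde R D.
Proof. by rewrite /Delta_tilde; apply: le_bigmax. Qed.

Lemma Delta_tilde_ge0 (R : realType) (D : digraph) : 0 <= Delta_tilde R D.
Proof. exact: bigmax_ge_id. Qed.

Theorem theorem1p5 (R : realType) (D : digraph) (hD : oriented D) :
  [/\ (dichromatic D)%:R <= 1 / 3 * (max_degree (underlying D))%:R + 2 :> R,
      (dichromatic D)%:R <= 2 / 3 * (Delta_max D)%:R + 2 :> R
    & (dichromatic D)%:R <= Num.sqrt 2 / 2 * Delta_tilde R D + 2 :> R].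
Proof.
have first_bound : (dichromatic D)%:R <= 1 / 3 * (max_degree (underlying D))%:R + 2 :> R.
  have : (3 * dichromatic D <= max_degree (underlying D) + 6)%N.
    by have := dichromatic_degree hD; lia.
  by rewrite -(ler_nat R) natrD natrM; lra.
split=> //.
  have := max_degree_le hD; rewrite -(ler_nat R) natrM; lra.
have D0 := Delta_tilde_ge0 R D; have s0 : 0 <= Num.sqrt 2 :> R := sqrtr_ge0 2.
have [n2|n3] := leqP (dichromatic D) 2.
  have : (dichromatic D)%:R <= 2 :> R by rewrite ler_nat.
  have : 0 <= Num.sqrt 2 / 2 * Delta_tilde R D by rewrite mulr_ge0 // divr_ge0.
  lra.
rewrite leNgt; apply/negP => big.
pose k := (dichromatic D).-1.
have kE : dichromatic D = k.+1 by rewrite /k; lia.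
have k1 : (1 < k)%N by lia.
suff [f /dichromatic_le] :
    exists f : D -> 'I_k, no_monochromatic (circular (@is_arc D)) setT f.
  by rewrite kE ltnn.
apply: coloring_product => // [|v]; first exact: is_arc_irr.
rewrite -(ltr_nat R) natrM -/(outdeg v) -/(indeg v).
set P := _ * _; have P0 : 0 <= P by rewrite mulr_ge0.
have Pt := Delta_tilde_ge R v; rewrite -/P in Pt.
have k1R : 1 + k.-1%:R = k%:R :> R by rewrite -[in RHS](prednK (ltnW k1)) -natr1 addrC.
have lt_k : Num.sqrt 2 * Num.sqrt P < 2 * k.-1%:R.
  have : Num.sqrt 2 * Num.sqrt P <= Num.sqrt 2 * Delta_tilde R D by apply: ler_wpM2l.
  have kR : (dichromatic D)%:R = k%:R + 1 :> R by rewrite kE natr1.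
  by move: big; rewrite kR -k1R; lra.
have : (Num.sqrt 2 * Num.sqrt P) ^+ 2 < (2 * k.-1%:R) ^+ 2.
  by rewrite ltr_pXn2r // ?nnegrE ?mulr_ge0 ?sqrtr_ge0.
rewrite !exprMn !sqr_sqrtr // natrM natrX; lra.
Qed.
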